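(* Let $\mathcal{X}$ be a 3-order real tensor of size $I_1\times I_2\times I_3$, let $\mathcal{G}$ be a 3-order real tensor of size $J_1\times J_2\times J_3$, and let $A_k\in\mathbb{R}^{I_k\times J_k}$, $k=1,2,3$, be matrices such that $\mathcal{X}=[[\mathcal{G};A_1,A_2,A_3]]$. Then for every non-identity permutation $\sigma\in S_3$, $$\mathcal{X}^{T\sigma}=[[\mathcal{G}^{T\sigma};A_{\sigma(1)},A_{\sigma(2)},A_{\sigma(3)}]].$$
   Context: Tensor transpose: for a non-identity permutation $\sigma\in S_N$ and an $N$-order tensor $\mathcal{X}$ of size $I_1\times\cdots\times I_N$, the transpose $\mathcal{X}^{T\sigma}$ is the tensor of size $I_{\sigma(1)}\times\cdots\times I_{\sigma(N)}$ with entries $\mathcal{X}^{T\sigma}(i_{\sigma(1)},\dots,i_{\sigma(N)})=\mathcal{X}(i_1,\dots,i_N)$ for all indices. $n$-mode product: for $\mathcal{X}$ of size $I_1\times\cdots\times I_N$ and a matrix $U$ of size $J_n\times I_n$, $\mathcal{X}\times_n U$ is the tensor of size $I_1\times\cdots\times I_{n-1}\times J_n\times I_{n+1}\times\cdots\times I_N$ with entries $(\mathcal{X}\times_n U)(i_1,\dots,i_{n-1},j_n,i_{n+1},\dots,i_N)=\sum_{i_n=1}^{I_n}\mathcal{X}(i_1,\dots,i_N)\,U(j_n,i_n)$. Tucker decomposition notation: $[[\mathcal{G};A_1,A_2,A_3]]:=\mathcal{G}\times_1A_1\times_2A_2\times_3A_3$. Equivalently, it is $\sum_{j_1=1}^{J_1}\sum_{j_2=1}^{J_2}\sum_{j_3=1}^{J_3}\mathcal{G}(j_1,j_2,j_3)\,a_{j_1}\circ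 b_{j_2}\circ c_{j_3}$, where $a_j,b_j,c_j$ are the $j$-th columns of $A_1,A_2,A_3$ and $\circ$ is the outer product. *)

(* Defs.v *)
From HB Require Import structures.
From mathcomp Require Import all_boot all_order all_algebra all_fingroup.
From mathcomp Require Import reals.

Set Implicit Arguments.
Unset Strict Implicit.
Unset Printing Implicit Defensive.

Import GRing.Theory.
Local Open Scope ring_scope.

(** Multi-indices and tensors of order [N]; positions and indices are numbered
    from 0, and [I k] is the size of the tensor along position [k]. *)

Definition multi_index (N : nat) (I : 'I_N -> nat) : finType :=
  {dffun forall k : 'I_N, 'I_(I k)}.

Definition tensor (R : realType) (N : nat) (I : 'I_N -> nat) : Type :=
  {ffun multi_index I -> R}.

(** Sizes that are equal pointwise need not be convertible; the two casts below
    leave the numerical values of all indices unchanged. *)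

Definition cast_index (N : nat) (I I' : 'I_N -> nat) (eqI : I =1 I')
    (i : multi_index I) : multi_index I' :=
  [ffun k => cast_ord (eqI k) (i k)].

Definition cast_tensor (R : realType) (N : nat) (I I' : 'I_N -> nat)
    (eqI : I =1 I') (X : tensor R I) : tensor R I' :=
  [ffun i' => X (cast_index (fsym eqI) i')].

Section Transpose.
Variables (N : nat) (I : 'I_N -> nat) (s : 'S_N).

(** [(i_1, ..., i_N) |-> (i_(s 1), ..., i_(s N))] and its inverse. *)
Definition perm_index (i : multi_index I) : multi_index (fun k => I (s k)) :=
  [ffun k => i (s k)].

Definition unperm_index (j : multi_index (fun k => I (s k))) : multi_index I :=
  [ffun k => cast_ord (congr1 I (permKV s k)) (j (s^-1%g k))].

Lemma perm_indexK : cancel perm_index unperm_index.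
Proof.
move=> i; apply/ffunP => k; rewrite !ffunE; apply: val_inj => /=.
by rewrite permKV.
Qed.

Definition transpose (R : realType) (X : tensor R I) :
    tensor R (fun k => I (s k)) :=
  [ffun j => X (unperm_index j)].

Lemma transposeE (R : realType) (X : tensor R I) (i : multi_index I) :
  transpose X (perm_index i) = X i.
Proof. by rewrite ffunE perm_indexK. Qed.

End Transpose.

Section ModeProduct.
Variables (N : nat) (I : 'I_N -> nat) (n : 'I_N) (Jn : nat).

Definition set_size : 'I_N -> nat := fun k => if k == n then Jn else I k.

Lemma set_size_eq : set_size n = Jn.
Proof. by rewrite /set_size eqxx. Qed.

Lemma set_size_neq k : k <> n -> set_size k = I k.
Proof. by move=> /eqP/negPf kn; rewrite /set_size kn. Qed.

(** [(i_1, ..., j_n, ..., i_N)] with the entry at position [n] replaced by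
    [in_]. *)
Definition subst_index (j : multi_index set_size) (in_ : 'I_(I n)) :
    multi_index I :=
  [ffun k => match k =P n with
             | ReflectT kn => cast_ord (congr1 I (esym kn)) in_
             | ReflectF kn => cast_ord (set_size_neq kn) (j k)
             end].

Definition mode_prod (R : realType) (X : tensor R I) (U : 'M[R]_(Jn, I n)) :
    tensor R set_size :=
  [ffun j => \sum_(in_ < I n)
     X (subst_index j in_) * U (cast_ord set_size_eq (j n)) in_].

End ModeProduct.

Definition mode1 : 'I_3 := @Ordinal 3 0 isT.
Definition mode2 : 'I_3 := @Ordinal 3 1 isT.
Definition mode3 : 'I_3 := @Ordinal 3 2 isT.

Lemma tucker_size (J I : 'I_3 -> nat) :
  set_size (set_size (set_size J mode1 (I mode1)) mode2 (I mode2))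
    mode3 (I mode3) =1 I.
Proof.
by case=> [[|[|[|k]]] lt_k3] //; rewrite /set_size /=; congr I; apply: val_inj.
Qed.

(** [[[G; A1, A2, A3]]], that is, [G x_1 A1 x_2 A2 x_3 A3]. *)
Definition tucker (R : realType) (J I : 'I_3 -> nat) (G : tensor R J)
    (A1 : 'M[R]_(I mode1, J mode1)) (A2 : 'M[R]_(I mode2, J mode2))
    (A3 : 'M[R]_(I mode3, J mode3)) : tensor R I :=
  cast_tensor (tucker_size J I)
    (mode_prod (n := mode3) (mode_prod (n := mode2) (mode_prod (n := mode1)
       G A1) A2) A3).

(* Main.v *)
(** Both sides have entries [\sum_j G j * \prod_k A k (i k) (j k)], up to
    renaming the positions [k] and the summation index [j] by [s]. *)

Require Import Defs.
From HB Require Import structures.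
From mathcomp Require Import all_boot all_order all_algebra all_fingroup.
From mathcomp Require Import reals.

Set Implicit Arguments.
Unset Strict Implicit.
Unset Printing Implicit Defensive.

Import GRing.Theory.

(** Unfolding the three mode products gives an entry formula, [tuckerE], in which the modes play
    symmetric roles: one sum over multi-indices and one product over positions. Transposition then
    amounts to two reindexings: the sum along the bijection [unperm_index], and the product along
    [s], which commutativity of the scalars allows. *)

Lemma subst_index_eq N (I : 'I_N -> nat) n Jn
    (j : multi_index (set_size I n Jn)) (x : 'I_(I n)) :
  subst_index j x n = x.
Proof. by rewrite ffunE; case: eqP => // e; apply: val_inj. Qed.

(** Compared in [nat], since the bounds [I k] and [set_size I n Jn k] are not convertible. *)
Lemma subst_index_neq N (I : 'I_N -> nat) n Jn
    (j : multi_index (set_size I n Jn)) (x : 'I_(I n)) k :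
  k != n -> subst_index j x k = j k :> nat.
Proof. by rewrite ffunE; case: eqP. Qed.

Lemma mode_ind (P : 'I_3 -> Prop) :
  P mode1 -> P mode2 -> P mode3 -> forall k, P k.
Proof.
move=> P1 P2 P3 [[|[|[|//]]] lt_k3].
- by rewrite (_ : Ordinal _ = mode1) //; apply: val_inj.
- by rewrite (_ : Ordinal _ = mode2) //; apply: val_inj.
- by rewrite (_ : Ordinal _ = mode3) //; apply: val_inj.
Qed.

Lemma prod_mode (R : comPzRingType) (F : 'I_3 -> R) :
  (\prod_k F k = F mode1 * F mode2 * F mode3)%R.
Proof.
rewrite !big_ord_recl big_ord0 mulr1 mulrA.
by do !congr (_ * _)%R; congr F; apply: val_inj.
Qed.

(** Taking the matrices as one family [A] over positions is what makes the product permutable later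
    on. *)
Lemma tuckerE (R : realType) (I J : 'I_3 -> nat) (G : tensor R J)
    (A : forall k : 'I_3, 'M[R]_(I k, J k)) (i : multi_index I) :
  (tucker G (A mode1) (A mode2) (A mode3) i =
   \sum_(j : multi_index J) G j * \prod_k A k (i k) (j k))%R.
Proof.
rewrite ffunE; set i' := cast_index _ i.
have i'E k : i' k = i k :> nat by rewrite ffunE.
(* This is the index at which the nested mode products read [G]. Every entry of [i'] gets
   overwritten, so triples correspond bijectively to multi-indices; mode 3 comes first because its
   sum is outermost. *)
pose ix (p : 'I_(J mode3) * 'I_(J mode2) * 'I_(J mode1)) : multi_index J :=
  subst_index (n := mode1) (subst_index (n := mode2)
    (subst_index (n := mode3) i' p.1.1) p.1.2) p.2.
have ix1 p : ix p mode1 = p.2 by rewrite /ix subst_index_eq.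
have ix2 p : ix p mode2 = p.1.2.
  apply: val_inj; rewrite [LHS]subst_index_neq //.
  by congr val; apply: subst_index_eq.
have ix3 p : ix p mode3 = p.1.1.
  apply: val_inj; rewrite [LHS]subst_index_neq // [LHS]subst_index_neq //.
  by congr val; apply: subst_index_eq.
have ix_bij : bijective ix.
  exists (fun j : multi_index J => (j mode3, j mode2, j mode1)) => [[[c b] a]|j].
    by rewrite ix1 ix2 ix3.
  by apply/ffunP; elim/mode_ind; rewrite ?ix1 ?ix2 ?ix3.
rewrite (reindex ix); last exact: onW_bij.
transitivity (\sum_(c < J mode3) \sum_(b < J mode2) \sum_(a < J mode1)
  G (ix (c, b, a)) * (A mode1 (i mode1) a * A mode2 (i mode2) b
    * A mode3 (i mode3) c))%R; last first.
  rewrite pair_bigA pair_bigA; apply: eq_bigr => -[[c b] a] _.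
  by rewrite prod_mode ix1 ix2 ix3.
rewrite ffunE; apply: eq_bigr => c _.
rewrite ffunE mulr_suml; apply: eq_bigr => b _.
rewrite ffunE !mulr_suml; apply: eq_bigr => a _.
(* Only the row indices remain: substitutions made at later modes leave the entry at the current
   mode equal to that of [i]. *)
rewrite !mulrA; congr (_ * A mode1 _ _ * A mode2 _ _ * A mode3 _ _)%R.
- by apply: val_inj; rewrite /= !subst_index_neq.
- by apply: val_inj; rewrite /= !subst_index_neq.
- by apply: val_inj; rewrite /= i'E.
Qed.

(** Evaluating at [s k] cancels [s^-1] and makes both types ['I_(I (s k))], so no cast survives. *)
Lemma unperm_indexE N (I : 'I_N -> nat) (s : 'S_N)
    (j : multi_index (fun k => I (s k))) k :
  unperm_index j (s k) = j k.
Proof. by apply: val_inj; rewrite ffunE /= permK. Qed.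

Lemma unperm_indexK N (I : 'I_N -> nat) (s : 'S_N) :
  cancel (@unperm_index N I s) (@perm_index N I s).
Proof. by move=> j; apply/ffunP => k; rewrite ffunE unperm_indexE. Qed.

Theorem proposition5p4 (R : realType) (I J : 'I_3 -> nat)
    (X : tensor R I) (G : tensor R J)
    (A : forall k : 'I_3, 'M[R]_(I k, J k)) :
  X = tucker G (A mode1) (A mode2) (A mode3) ->
  forall s : 'S_3, s != 1%g ->
    transpose s X =
      tucker (transpose s G) (A (s mode1)) (A (s mode2)) (A (s mode3)).
Proof.
move=> -> s _; apply/ffunP => i; rewrite ffunE tuckerE.
rewrite (tuckerE (transpose s G) (fun k => A (s k))).
rewrite (reindex (@unperm_index _ J s)); last first.
  apply: onW_bij; exists (@perm_index _ J s).
    exact: unperm_indexK.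
  exact: perm_indexK.
apply: eq_bigr => j _; rewrite ffunE; congr (_ * _)%R.
(* The factor at [s k] on the left becomes the factor at [k] for the family [A (s k)]. *)
rewrite (reindex_perm s); apply: eq_bigr => k _.
by rewrite !unperm_indexE.
Qed.
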